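(* If $n\ge m\ge 3$ are integers and there exists a maximally nonassociative quasigroup of order $n$, then there exists a maximally nonassociative quasigroup of order $nm$.
   Context: A quasigroup is a set $Q$ with a binary operation $\cdot$ such that for all $a,b\in Q$ the equations $x\cdot a=b$ and $a\cdot y=b$ have unique solutions $x,y\in Q$. Its order is $|Q|$. A quasigroup $Q$ is maximally nonassociative if for all $x,y,z\in Q$, $x\cdot(y\cdot z)=(x\cdot y)\cdot z$ implies $x=y=z$. *)

(* Defs.v *)
From mathcomp Require Import all_boot.
Set Implicit Arguments.
Unset Strict Implicit.
Unset Printing Implicit Defensive.

Definition is_quasigroup (Q : Type) (op : Q -> Q -> Q) : Prop :=
  forall a b : Q,
    (exists! x : Q, op x a = b) /\ (exists! y : Q, op a y = b).

Definition maximally_nonassociative (Q : Type) (op : Q -> Q -> Q) : Prop :=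
  forall x y z : Q, op x (op y z) = op (op x y) z -> x = y /\ y = z.

Definition exists_max_nonassoc_quasigroup (n : nat) : Prop :=
  exists (Q : finType) (op : Q -> Q -> Q),
    [/\ #|Q| = n, is_quasigroup op & maximally_nonassociative op].

(* Main.v *)
Require Import Defs.
From mathcomp Require Import all_boot.
From mathcomp Require Import ssralg zmodp.
Set Implicit Arguments.
Unset Strict Implicit.
Unset Printing Implicit Defensive.
Import GRing.Theory.

(** Let [op] be a maximally nonassociative operation on Z_n and let M be an
    idempotent quasigroup of order m; these exist for every m >= 3. Fix an
    injection h of M into Z_n and put on Z_n x M the operation
      (x, a) (y, b) = (x + y + h a, a b)  if a <> b,
      (x, a) (y, a) = (op x y, a).
    If (a, b, c) is a non-diagonal associative triple of M, idempotence and
    cancellation force a <> b, b <> c, a <> b c and a b <> c, so that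
    associativity upstairs reduces to h a + h b = h (a b) + h a, hence to
    b = a b and a = b, a contradiction. On diagonal triples only [op]
    intervenes. *)

Lemma quasigroup_cancel (Q : Type) (op : Q -> Q -> Q) :
  is_quasigroup op ->
  (forall a, injective (op a)) /\ (forall a, injective (op^~ a)).
Proof.
move=> qop; split=> a x y /= exy.
  have [_ [z [_ uz]]] := qop a (op a y).
  by rewrite -(uz x exy) -(uz y erefl).
have [[z [_ uz]] _] := qop a (op y a).
by rewrite -(uz x exy) -(uz y erefl).
Qed.

Lemma cancel_quasigroup (Q : finType) (op : Q -> Q -> Q) :
  (forall a, injective (op a)) -> (forall a, injective (op^~ a)) ->
  is_quasigroup op.
Proof.
move=> injl injr a b; split.
  have [g _ gK] := injF_bij (injr a).
  exists (g b); split=> [|x xab]; first exact: (gK b).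
  by apply: (injr a) => /=; rewrite xab; apply: (gK b).
have [g _ gK] := injF_bij (injl a).
exists (g b); split=> [|x xab]; first exact: gK.
by apply: (injl a); rewrite xab gK.
Qed.

(** Transport to ['I_n] puts [op] on the carrier of Z_n, where an addition is at hand; the two need
    not be related. *)
Lemma max_nonassoc_ord n :
  exists_max_nonassoc_quasigroup n ->
  exists op : 'I_n -> 'I_n -> 'I_n,
    is_quasigroup op /\ maximally_nonassociative op.
Proof.
case=> Q [op [<- qop mop]].
have [injl injr] := quasigroup_cancel qop.
exists (fun x y => enum_rank (op (enum_val x) (enum_val y))); split.
  apply: cancel_quasigroup => a x y /enum_rank_inj.
    by move/injl/enum_val_inj.
  by move/injr/enum_val_inj.
move=> x y z; rewrite !enum_rankK => /enum_rank_inj /mop [].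
by move=> /enum_val_inj -> /enum_val_inj ->.
Qed.

Section OddCyclic.

Variable k : nat.
Hypothesis odd_k : odd k.
Local Open Scope ring_scope.

(** The difference [d] is killed by 2 and by the odd number k + 2, hence by 1. *)
Lemma odd_double_inj : injective (fun x : 'I_k.+2 => x + x).
Proof.
move=> x y exy; apply/eqP; rewrite -subr_eq0; apply/eqP.
set d := x - y.
have d2 : d *+ 2 = 0 by rewrite mulrnBl !mulr2n exy subrr.
have dk : d *+ k.+2 = 0.
  by rewrite Zp_mulrn; apply: val_inj; rewrite /= modnMl.
have odd_k2 : odd k.+2 by rewrite /= negbK.
move: dk; rewrite -(odd_double_half k.+2) odd_k2 -mul2n.
by rewrite mulrnDr mulrnA d2 mul0rn addr0.
Qed.

(** The core of the cyclic group, or dihedral quandle: y is reflected in x. *)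
Definition reflect_op (x y : 'I_k.+2) : 'I_k.+2 := x + x - y.

Lemma reflect_op_idem x : reflect_op x x = x.
Proof. exact: addrK. Qed.

Lemma reflect_op_injl a : injective (reflect_op a).
Proof. by move=> x y /addrI /oppr_inj. Qed.

Lemma reflect_op_injr a : injective (reflect_op^~ a).
Proof. by move=> x y /addIr /odd_double_inj. Qed.

(** Since x - 1 runs over all residues, the cells (x, x + 1) carry each symbol once. *)
Lemma reflect_op_succ x : reflect_op x (x + 1) = x - 1.
Proof. by rewrite /reflect_op opprD addrA addrK. Qed.

(* The cells (x, x + 1) form a transversal of [reflect_op] off the diagonal;
   its entries are moved to the new row and column [None], and replaced by
   [None]. *)
Definition prolong_op (u v : option 'I_k.+2) : option 'I_k.+2 :=
  match u, v with
  | Some x, Some y => if y == x + 1 then None else Some (reflect_op x y)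
  | Some x, None => Some (reflect_op x (x + 1))
  | None, Some y => Some (reflect_op (y - 1) y)
  | None, None => None
  end.

Lemma prolong_op_idem u : prolong_op u u = u.
Proof.
case: u => [x|] //=; rewrite reflect_op_idem ifN //.
(* The emptied cells avoid the diagonal because 1 is nonzero in Z_(k+2). *)
by rewrite -subr_eq0 opprD addrA subrr sub0r oppr_eq0 oner_eq0.
Qed.

Lemma prolong_op_injl a : injective (prolong_op a).
Proof.
case: a => [x|] [y|] [z|] //=.
- have [->|_] := eqVneq y (x + 1); have [->|_] := eqVneq z (x + 1) => //.
  by move=> /Some_inj/reflect_op_injl ->.
- have [//|ny] := eqVneq y (x + 1).
  by move=> /Some_inj/reflect_op_injl ey; rewrite ey eqxx in ny.
- have [//|nz] := eqVneq z (x + 1).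
  by move=> /Some_inj/reflect_op_injl ez; rewrite -ez eqxx in nz.
(* Row [None] is y -> y - 2, seen by writing y as (y - 1) + 1. *)
- rewrite -{2}(subrK 1 y) -{2}(subrK 1 z) !reflect_op_succ.
  by move=> /Some_inj/addIr/addIr ->.
Qed.

Lemma prolong_op_injr a : injective (prolong_op^~ a).
Proof.
case: a => [x|] [y|] [z|] //=.
- have [->|_] := eqVneq x (y + 1); have [|_] := eqVneq _ (z + 1) => //.
    by move=> /addIr ->.
  by move=> /Some_inj/reflect_op_injr ->.
- have [//|ny] := eqVneq x (y + 1).
  by move=> /Some_inj/reflect_op_injr ey; rewrite ey subrK eqxx in ny.
- have [//|nz] := eqVneq x (z + 1).
  by move=> /Some_inj/reflect_op_injr ez; rewrite -ez subrK eqxx in nz.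
- by rewrite !reflect_op_succ; move=> /Some_inj/addIr ->.
Qed.

End OddCyclic.

(** Reflections in Z_m serve for odd m, the prolongation of Z_(m-1) for even m. *)
Lemma exists_idempotent_quasigroup m : 3 <= m ->
  exists (M : finType) (mul : M -> M -> M),
    [/\ #|M| = m, forall a, injective (mul a), forall a, injective (mul^~ a)
      & forall a, mul a a = a].
Proof.
case: m => [|[|k]] // k_gt0.
have [odd_k|even_k] := boolP (odd k).
  exists 'I_k.+2, (@reflect_op k); split; first exact: card_ord.
  - exact: reflect_op_injl.
  - exact: reflect_op_injr.
  - exact: reflect_op_idem.
(* As m is even and not 2, m - 1 is odd and at least 3. *)
case: k k_gt0 even_k => [|k] // _ /negbNE odd_k.
exists (option 'I_k.+2), (@prolong_op k); split.
- by rewrite card_option card_ord.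
- exact: prolong_op_injl.
- exact: prolong_op_injr.
- exact: prolong_op_idem.
Qed.

Section TwistedProduct.

Variables (Q : zmodType) (op : Q -> Q -> Q).
Variables (M : eqType) (mul : M -> M -> M) (h : M -> Q).
Local Open Scope ring_scope.

Definition twisted_fiber (a b : M) (x y : Q) : Q :=
  if a == b then op x y else x + y + h a.

Definition twisted_op (u v : Q * M) : Q * M :=
  (twisted_fiber u.2 v.2 u.1 v.1, mul u.2 v.2).

Hypothesis mul_injl : forall a, injective (mul a).
Hypothesis mul_injr : forall a, injective (mul^~ a).

Lemma twisted_op_injl :
  (forall a, injective (op a)) -> forall u, injective (twisted_op u).
Proof.
(* The second components give b = c first, so both sides use the same case of [twisted_fiber]. *)
move=> op_injl [x a] [y b] [z c] [/[swap] /mul_injl <-].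
rewrite /twisted_fiber /=; case: eqP => _; first by move/op_injl ->.
by move=> /addIr /addrI ->.
Qed.

Lemma twisted_op_injr :
  (forall a, injective (op^~ a)) -> forall u, injective (twisted_op^~ u).
Proof.
move=> op_injr [x a] [y b] [z c] [/[swap] /mul_injr <-].
rewrite /twisted_fiber /=; case: eqP => _; first by move/op_injr ->.
by move=> /addIr /addIr ->.
Qed.

Hypothesis mul_idem : forall a, mul a a = a.
Hypothesis h_inj : injective h.

Lemma idem_mul_eql a b : (mul a b == a) = (a == b).
Proof.
apply/eqP/eqP => [e|<- //]; apply: (mul_injl (a := a)).
by rewrite e mul_idem.
Qed.

Lemma idem_mul_eqr a b : (mul a b == b) = (a == b).
Proof.
apply/eqP/eqP => [e|-> //]; apply: (mul_injr (a := b)).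
by rewrite e /= mul_idem.
Qed.

Lemma twisted_op_max_nonassoc :
  maximally_nonassociative op -> maximally_nonassociative twisted_op.
Proof.
move=> mop [x a] [y b] [z c] [/= exyz eabc].
have [eab|nab] := eqVneq a b.
  (* From a (a c) = a c, cancelling a gives a c = c. *)
  subst b; have eac : a = c.
    apply/eqP; rewrite -idem_mul_eqr; apply/eqP/(mul_injl (a := a)).
    by rewrite eabc mul_idem.
  subst c; move: exyz; rewrite /twisted_fiber !mul_idem !eqxx.
  by case/mop=> -> ->.
have [ebc|nbc] := eqVneq b c.
  subst c; case/negP: nab; rewrite -idem_mul_eql; apply/eqP.
  by apply: (mul_injr (a := b)); rewrite /= -eabc mul_idem.
(* If a = b c, then (a b) c = a a = b c, so a b = b. *)
have na_bc : a != mul b c.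
  apply: contra nab => /eqP ea; rewrite -idem_mul_eqr.
  apply/eqP/(mul_injr (a := c)); rewrite /= -eabc -ea; exact: mul_idem.
(* If a b = c, then a (b c) = c c = a b, so b c = b. *)
have nab_c : mul a b != c.
  apply: contra nbc => /eqP ec; rewrite -idem_mul_eql.
  apply/eqP/(mul_injl (a := a)); rewrite eabc ec; exact: mul_idem.
move: exyz; rewrite /twisted_fiber (negPf nab) (negPf nbc) (negPf na_bc).
rewrite (negPf nab_c) => exyz; case/negP: nab; rewrite -idem_mul_eqr.
apply/eqP/h_inj/(addrI (x + y + h a + z)); rewrite -exyz !addrA.
by rewrite (addrAC _ (h b)) (addrAC _ z).
Qed.

End TwistedProduct.

Theorem corollary2p4 (n m : nat) (hm : 3 <= m) (hmn : m <= n)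
  (hn : exists_max_nonassoc_quasigroup n) :
  exists_max_nonassoc_quasigroup (n * m).
Proof.
have [M [mul [cardM mul_injl mul_injr mul_idem]]] :=
  exists_idempotent_quasigroup hm.
have [op [qop mop]] := max_nonassoc_ord hn.
(* Z_n is a group only for positive n, which 3 <= m <= n ensures. *)
case: n hmn {hn} op qop mop => [|n] hmn op qop mop.
  by rewrite leqn0 in hmn; rewrite (eqP hmn) in hm.
have [op_injl op_injr] := quasigroup_cancel qop.
rewrite -cardM in hmn.
pose h (a : M) : 'I_n.+1 := widen_ord hmn (enum_rank a).
have h_inj : injective h.
  by move=> a b /(congr1 val) /= /val_inj /enum_rank_inj.
exists ('I_n.+1 * M)%type, (twisted_op op mul h); split.
- by rewrite card_prod card_ord cardM.
- by apply: cancel_quasigroup; [exact: twisted_op_injl | exact: twisted_op_injr].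
- exact: twisted_op_max_nonassoc.
Qed.
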